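(* Let $P$ be a loop-free procedure which calls another loop-free procedure $P'$. Let $P^{\#}$ be the version of $P$ in which all calls to $P'$ have been replaced by the summary of $P'$. Then every feasible execution of $P^{\#}$ is also a feasible execution of $P$.
   Context: Procedures. A procedure has parameters, possibly a return variable, local variables, access to global variables, and finitely many blocks. Each block is a finite sequence of statements followed by a non-deterministic goto to a set of successor blocks; there is a unique initial block and a unique final block (the only one without successors). Statements are assignments $v:=e$, assumptions $\mathbf{assume}\ E$ ($E$ Boolean; expressions are first-order terms interpreted in a fixed background structure), and calls $z:=\mathbf{call}\ Q(e_1,\dots,e_k)$. Loop-free means the successor graph is acyclic. A complete path goes from the initial to the final block. Executions. A feasible execution of a procedure is a complete path together with a sequence of states (valuations of the procedure's variables and the global variables), one before and after each statement along the path, such that: an assignment updates the assigned variable; $\mathbf{assume}\ E$ leaves the state unchanged and $E$ is true in it; a call $z:=\mathbf{call}\ Q(e_1,\dots,e_k)$ leads from state $s$ to state $s'$ only if there is a feasible execution of $Q$ that starts with its parameters equal to the values of $e_1,\dots,e_k$ in $s$ and the global variables as in $s$ (all other variables of $Q$ arbitrary), and $s'$ arises from $s$ by giving the global variables their values at the end of this execution of $Q$ and then giving $z$ the final value of the return variable of $Q$. Reachability verification condition of $P'$. All calls inside $P'$ have been eliminated by inlining. $P'$ is put into single static assignment form: every variable $v$ is split into incarnations $v_0,\dots,v_n$ ($n$ depending on $v$; $v_0$ is the value at entry, $v_n$ the maximal incarnation, which holds the value of $v$ at exit on every path, with copies added at join points so that this is the case), each written at most once on each path, and every assignment is replaced by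 an assumption of the corresponding equality. Let the resulting blocks be numbered $0,\dots,N$ ($0$ initial, $N$ final) with assume-only statement sequences $S_i$, successor sets $Succ_i$ and predecessor sets $Pre_i$. With $wlp(\mathbf{assume}\ E,Q)=(E\Rightarrow Q)$, $wlp(S;T,Q)=wlp(S,wlp(T,Q))$ and fresh Boolean variables $B_i,R_i$, $$VC:\ \bigwedge_{0\le i<N}\Bigl(B_i\equiv\neg wlp\bigl(S_i,\bigwedge_{j\in Succ_i}\neg B_j\bigr)\Bigr)\wedge\bigl(B_N\equiv\neg wlp(S_N,\mathrm{false})\bigr)\wedge(R_0\equiv B_0)\wedge\bigwedge_{1\le i\le N}\Bigl(R_i\equiv B_i\wedge\bigvee_{j\in Pre_i}R_j\Bigr).$$ Summary of $P'$. Let $TC$ be the finite set of valuations returned for $P'$ by one of two covering algorithms that repeatedly ask a theorem prover for satisfying valuations of $VC$ conjoined with further clauses over the $R_i$. All that matters here is that $TC$ is a finite set of valuations $\nu$ of all incarnations and auxiliary variables with $\nu\models VC$ and $\nu(R_0)=\mathrm{true}$, i.e. each $\nu$ contains the values of all incarnations on a feasible execution of $P'$. Let $V$ be the set of variables of $P'$ visible to the outside: its parameters, its return variable, and the global variables. The summary of $P'$ is the formula $$Sum := \bigvee_{\nu\in TC}\Bigl(\bigwedge_{v\in V}(v_0=\nu(v_0))\wedge\bigwedge_{v\in V}(v_n=\nu(v_n))\Bigr),$$ where $n$ denotes the maximal incarnation of the respective variable $v$. The procedure $P^{\#}$. Each call $z:=\mathbf{call}\ P'(e_1,\dots,e_k)$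 in $P$ is replaced, using fresh copies of the variables $v_0,v_n$ ($v\in V$) for each call, by: assumptions that the incarnation-$0$ parameters equal $e_1,\dots,e_k$ and that the incarnation-$0$ global variables equal the current global variables; then $\mathbf{assume}\ Sum$; then the global variables receive the values of their maximal incarnations and $z$ receives the value of the maximal incarnation of the return variable. (The initial incarnation of the return variable is otherwise unconstrained.) A feasible execution of $P^{\#}$ is regarded as an execution over the blocks and variables of $P$ by treating each such replacement sequence as a single step and forgetting the fresh variables. *)

(* Defs.v *)
From mathcomp Require Import all_boot.

Set Implicit Arguments.
Unset Strict Implicit.
Unset Printing Implicit Defensive.

(* A (single-sorted) first-order structure.  Booleans that a program stores in
   variables are elements of [dom]; Boolean expressions are formulas. *)
Record structure := Structure {
  dom : Type;
  fsym : Type;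
  far : fsym -> nat;
  fint : forall f : fsym, (far f).-tuple dom -> dom;
  rsym : Type;
  rar : rsym -> nat;
  rint : forall r : rsym, (rar r).-tuple dom -> Prop
}.

Section Formulas.

Variable M : structure.

(* [Lit] names the elements of the structure; summaries mention the values of
   arbitrary valuations, which need not be denoted by a closed term. *)
Inductive term (V : Type) : Type :=
| Var of V
| Lit of dom M
| App (f : fsym M) of ('I_(far f) -> term V).

(* [V]: variables ranging over the structure, [B]: Boolean variables. *)
Inductive form (V B : Type) : Type :=
| FTrue
| FFalse
| FBool of B
| FRel (r : rsym M) of ('I_(rar r) -> term V)
| FEq of term V & term V
| FNot of form V B
| FAnd of form V B & form V B
| FOr of form V B & form V B
| FImp of form V B & form V B
| FIff of form V B & form V B.

Fixpoint term_map V W (h : V -> W) (t : term V) : term W :=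
  match t with
  | Var v => Var (h v)
  | Lit d => Lit W d
  | App f a => App (fun i => term_map h (a i))
  end.

Fixpoint form_map V W B C (h : V -> W) (k : B -> C) (E : form V B) : form W C :=
  match E with
  | FTrue => FTrue W C
  | FFalse => FFalse W C
  | FBool b => FBool W (k b)
  | FRel r a => FRel C (fun i => term_map h (a i))
  | FEq t u => FEq C (term_map h t) (term_map h u)
  | FNot E1 => FNot (form_map h k E1)
  | FAnd E1 E2 => FAnd (form_map h k E1) (form_map h k E2)
  | FOr E1 E2 => FOr (form_map h k E1) (form_map h k E2)
  | FImp E1 E2 => FImp (form_map h k E1) (form_map h k E2)
  | FIff E1 E2 => FIff (form_map h k E1) (form_map h k E2)
  end.

Fixpoint eval V (s : V -> dom M) (t : term V) : dom M :=
  match t with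
  | Var v => s v
  | Lit d => d
  | App f a => fint [tuple eval s (a i) | i < far f]
  end.

Fixpoint holds V B (s : V -> dom M) (beta : B -> bool) (E : form V B) : Prop :=
  match E with
  | FTrue => True
  | FFalse => False
  | FBool b => beta b
  | FRel r a => rint [tuple eval s (a i) | i < rar r]
  | FEq t u => eval s t = eval s u
  | FNot E1 => ~ holds s beta E1
  | FAnd E1 E2 => holds s beta E1 /\ holds s beta E2
  | FOr E1 E2 => holds s beta E1 \/ holds s beta E2
  | FImp E1 E2 => holds s beta E1 -> holds s beta E2
  | FIff E1 E2 => holds s beta E1 <-> holds s beta E2
  end.

Definition FAll V B (Es : seq (form V B)) : form V B :=
  foldr (@FAnd V B) (FTrue V B) Es.

Definition FAny V B (Es : seq (form V B)) : form V B :=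
  foldr (@FOr V B) (FFalse V B) Es.

(* The sequence [S] of formulas stands for [assume E] with [E] running
   through [S]. *)
Definition wlp V B (S : seq (form V B)) (Q : form V B) : form V B :=
  foldr (@FImp V B) Q S.

End Formulas.

Arguments Var M {V} _.
Arguments Lit {M} V _.
Arguments FTrue M V B : clear implicits.
Arguments FFalse M V B : clear implicits.
Arguments FBool M V {B} _.
Arguments FEq {M V} B _ _.

Section Programs.

(* [G]: the global variables, [name]: the procedure names. *)
Variables (M : structure) (G : finType) (name : eqType).

(* The variables of a procedure with non-global variables [L] (parameters,
   return variable and locals) together with the global ones. *)
Definition var (L : Type) : Type := (G + L)%type.

Definition var_map L L' (h : L -> L') (x : var L) : var L' :=
  match x with inl g => inl g | inr y => inr (h y) end.

(* In [Call z q es] there is no [z] if the result is not used or if [q] has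
   no return variable. *)
Inductive stmt (L : Type) : Type :=
| Assign of var L & term M (var L)
| Assume of form M (var L) void
| Call (z : option (var L)) (q : name) (es : seq (term M (var L))).

Definition stmt_map L L' (h : L -> L') (c : stmt L) : stmt L' :=
  match c with
  | Assign x e => Assign (var_map h x) (term_map (var_map h) e)
  | Assume E => Assume (form_map (var_map h) id E)
  | Call z q es =>
      Call (omap (var_map h) z) q [seq term_map (var_map h) e | e <- es]
  end.

(* [edge b c] means that [c] is a successor of [b]. *)
Record proc := Proc {
  loc : eqType;
  params : seq loc;
  ret : option loc;
  lab : finType;
  body : lab -> seq (stmt loc);
  edge : rel lab;
  init : lab;
  final : lab
}.

Definition loop_free (P : proc) : Prop :=
  forall p : seq (lab P), cycle (@edge P) p -> p = [::].

Definition complete (T : eqType) (e : rel T) (b c : T) (p : seq T) : bool :=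
  if p is b' :: p' then [&& b' == b, path e b' p' & last b' p' == c] else false.

Definition complete_path (P : proc) (p : seq (lab P)) : bool :=
  complete (@edge P) (init P) (final P) p.

Definition stmts_along (P : proc) (p : seq (lab P)) : seq (stmt (loc P)) :=
  flatten [seq body b | b <- p].

Definition call_free (P : proc) : Prop :=
  forall (b : lab P) pre z q es post, body b <> pre ++ Call z q es :: post.

Definition calls (P : proc) (q : name) : Prop :=
  exists (b : lab P) pre z es post, body b = pre ++ Call z q es :: post.

Definition state (L : Type) : Type := var L -> dom M.

Definition upd (L : eqType) (s : state L) (x : var L) (d : dom M) : state L :=
  fun y => if y == x then d else s y.

(* The state after a call of [Q] that was made in state [s], with result
   variable [z], and that ended in state [t]. *)
Definition after_call (L : eqType) (Q : proc) (z : option (var L))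
    (s : state L) (t : state (loc Q)) : state L :=
  let s' : state L := fun y => match y with inl g => t (inl g) | _ => s y end in
  match z, ret Q with
  | Some x, Some r => upd s' x (t (inr r))
  | _, _ => s'
  end.

Section Semantics.

Variable prog : name -> proc.

Definition wf_call (L : Type) (c : stmt L) : Prop :=
  if c is Call z q es then
    size es = size (params (prog q)) /\ (isSome z -> isSome (ret (prog q)))
  else True.

Definition wf_proc (P : proc) : Prop :=
  [/\ uniq (params P),
      forall b : lab P, (b == final P) = ~~ [exists c, edge b c] &
      forall (b : lab P) pre c post, body b = pre ++ c :: post -> wf_call c].

Definition wf_prog : Prop := forall q, wf_proc (prog q).

(* [feasible P p ss]: the path [p] with the states [ss], one before and one
   after each statement along [p]. *)
Inductive step (P : proc) :
    stmt (loc P) -> state (loc P) -> state (loc P) -> Prop :=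
| StepAssign x e s : step (Assign x e) s (upd s x (eval s e))
| StepAssume E s : holds s (of_void bool) E -> step (Assume E) s s
| StepCall z q es s p t ts :
    @feasible (prog q) p (t :: ts) ->
    [seq t (inr x) | x <- params (prog q)] = [seq eval s e | e <- es] ->
    (forall g, t (inl g) = s (inl g)) ->
    step (Call z q es) s (@after_call (loc P) (prog q) z s (last t ts))
with steps (P : proc) :
    seq (stmt (loc P)) -> seq (state (loc P)) -> Prop :=
| StepsNil s : steps [::] [:: s]
| StepsCons c cs s s' ss :
    step c s s' -> steps cs (s' :: ss) -> steps (c :: cs) [:: s, s' & ss]
with feasible (P : proc) : seq (lab P) -> seq (state (loc P)) -> Prop :=
| Feasible p ss :
    complete_path p -> steps (stmts_along p) ss -> feasible p ss.

Definition assign_result (L : Type) (z : option (var L)) (r : option (var L)) :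
    seq (stmt L) :=
  match z, r with
  | Some x, Some y => [:: Assign x (Var M y)]
  | _, _ => [::]
  end.

(* [P] with the call [z := call Q(es)] between [pre] and [post] in block [b]
   inlined: [Some (inl b)] keeps [pre], the [Some (inr _)] are the blocks of
   [Q], and [None] is a new block for [post]. *)
Definition inline_call (P Q : proc) (b : lab P) (pre : seq (stmt (loc P)))
    (z : option (var (loc P))) (es : seq (term M (var (loc P))))
    (post : seq (stmt (loc P))) : proc :=
  let L : eqType := (loc P + loc Q)%type in
  let ofP := stmt_map (inl : loc P -> L) in
  let ofQ := stmt_map (inr : loc Q -> L) in
  @Proc L
    [seq inl x | x <- params P]
    (omap inl (ret P))
    (option (lab P + lab Q)%type)
    (fun x => match x with
      | Some (inl c) =>
          if c == b then
            map ofP pre ++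
            [seq Assign (inr (inr xe.1) : var L)
                        (term_map (var_map inl) xe.2) | xe <- zip (params Q) es]
          else map ofP (body c)
      | Some (inr c) => map ofQ (body c)
      | None =>
          assign_result (omap (var_map inl) z)
                        (omap (fun r => inr (inr r) : var L) (ret Q)) ++
          map ofP post
      end)
    (fun x y => match x, y with
      | Some (inl c), Some (inl d) => (c != b) && edge c d
      | Some (inl c), Some (inr d) => (c == b) && (d == init Q)
      | Some (inr c), Some (inr d) => edge c d
      | Some (inr c), None => c == final Q
      | None, Some (inl d) => edge b d
      | _, _ => false
      end)
    (Some (inl (init P)))
    (if final P == b then None else Some (inl (final P))).

(* Only calls of loop-free procedures are inlined. *)
Inductive inlines : proc -> proc -> Prop :=
| InlineDone P : inlines P P
| InlineCall P P' (b : lab P) pre z q es post :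
    body b = pre ++ Call z q es :: post ->
    loop_free (prog q) ->
    inlines (@inline_call P (prog q) b pre z es post) P' ->
    inlines P P'.

End Semantics.

(* [(x, k)] is the incarnation k of [x]. *)
Definition inc (P : proc) : Type := (var (loc P) * nat)%type.

(* The Boolean variables of a verification condition with [n] blocks. *)
Inductive bvar (n : nat) : Type :=
| BVar of 'I_n
| RVar of 'I_n.

Section Incarnations.

Variables (P : proc) (n : nat).

Definition set_inc (i : var (loc P) -> nat) x k : var (loc P) -> nat :=
  fun y => if y == x then k else i y.

Definition at_inc (i : var (loc P) -> nat) (x : var (loc P)) : inc P := (x, i x).

(* [passive i cs S w j]: started with current incarnations [i], the call-free
   sequence [cs], followed by copies, becomes the sequence [S] of assumptions,
   which writes the incarnations [w] and ends with current incarnations [j]. *)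
Inductive passive : (var (loc P) -> nat) -> seq (stmt (loc P)) ->
    seq (form M (inc P) (bvar n)) -> seq (inc P) -> (var (loc P) -> nat) ->
    Prop :=
| PassiveNil i : passive i [::] [::] [::] i
| PassiveCopy i x k S w j :
    passive (set_inc i x k) [::] S w j ->
    passive i [::] (FEq (bvar n) (Var M (x, k)) (Var M (x, i x)) :: S)
            ((x, k) :: w) j
| PassiveAssume i E cs S w j :
    passive i cs S w j ->
    passive i (Assume E :: cs)
            (form_map (at_inc i) (of_void (bvar n)) E :: S) w j
| PassiveAssign i x e k cs S w j :
    passive (set_inc i x k) cs S w j ->
    passive i (Assign x e :: cs)
            (FEq (bvar n) (Var M (x, k)) (term_map (at_inc i) e) :: S)
            ((x, k) :: w) j.

End Incarnations.

(* Copies needed at a join are placed at the end of its predecessors; where a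
   predecessor has other successors as well, the edge is first split by a new
   block.  So the blocks of the passive program are those of [P] ([inl b])
   and one for each split edge ([inr (b, c)]); [blk] numbers them.
   [asm i] are the assumptions of block i, [written i] the incarnations they
   define, [inc_in i] and [inc_out i] the current incarnations at its ends,
   and [top x] is the maximal incarnation of [x]. *)
Record ssa (P : proc) := SSA {
  splits : rel (lab P);
  N : nat;
  blk : 'I_N.+1 -> lab P + lab P * lab P;
  asm : 'I_N.+1 -> seq (form M (inc P) (bvar N.+1));
  written : 'I_N.+1 -> seq (inc P);
  inc_in : 'I_N.+1 -> var (loc P) -> nat;
  inc_out : 'I_N.+1 -> var (loc P) -> nat;
  top : var (loc P) -> nat
}.

Section SSAForm.

Variables (P : proc) (F : ssa P).

Definition ssa_block (x : lab P + lab P * lab P) : bool :=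
  match x with
  | inl _ => true
  | inr (b, c) => edge b c && splits F b c
  end.

Definition ssa_source (x : lab P + lab P * lab P) : seq (stmt (loc P)) :=
  match x with
  | inl b => body b
  | inr _ => [::]
  end.

Definition ssa_edge (i j : 'I_(N F).+1) : bool :=
  match blk i, blk j with
  | inl b, inl c => edge b c && ~~ splits F b c
  | inl b, inr (b', _) => b == b'
  | inr (_, c'), inl c => c == c'
  | inr _, inr _ => false
  end.

Record ssa_form : Prop := SSAForm {
  ssa_blk_inj : injective (@blk P F);
  ssa_blk_im : forall x, ssa_block x <-> exists i : 'I_(N F).+1, blk i = x;
  ssa_init : blk (ord0 : 'I_(N F).+1) = inl (init P);
  ssa_final : blk (ord_max : 'I_(N F).+1) = inl (final P);
  ssa_passive : forall i : 'I_(N F).+1,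
    passive (inc_in i) (ssa_source (blk i)) (asm i) (written i) (inc_out i);
  ssa_entry : forall x, inc_in (ord0 : 'I_(N F).+1) x = 0;
  ssa_flow : forall i j, ssa_edge i j -> inc_out i =1 inc_in j;
  ssa_exit : forall x, inc_out (ord_max : 'I_(N F).+1) x = top F x;
  ssa_range : forall (i : 'I_(N F).+1) x k,
    (x, k) \in written i -> 0 < k <= top F x;
  ssa_once : forall p : seq 'I_(N F).+1,
    complete ssa_edge ord0 ord_max p -> uniq (flatten [seq written i | i <- p])
}.

Let Bv (i : 'I_(N F).+1) : form M (inc P) (bvar (N F).+1) :=
  FBool M (inc P) (BVar i).
Let Rv (i : 'I_(N F).+1) : form M (inc P) (bvar (N F).+1) :=
  FBool M (inc P) (RVar i).

Definition VC : form M (inc P) (bvar (N F).+1) :=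
  FAnd (FAll [seq FIff (Bv i)
                (FNot (wlp (asm i)
                   (FAll [seq FNot (Bv j) | j <- enum 'I_(N F).+1
                                          & ssa_edge i j])))
             | i : 'I_(N F).+1 <- enum 'I_(N F).+1 & i < N F])
 (FAnd (FIff (Bv ord_max) (FNot (wlp (asm ord_max) (FFalse _ _ _))))
 (FAnd (FIff (Rv ord0) (Bv ord0))
       (FAll [seq FIff (Rv i)
                (FAnd (Bv i)
                   (FAny [seq Rv j | j <- enum 'I_(N F).+1 & ssa_edge j i]))
             | i : 'I_(N F).+1 <- enum 'I_(N F).+1 & 0 < i]))).

Definition valuation : Type :=
  ((inc P -> dom M) * (bvar (N F).+1 -> bool))%type.

Definition visible : seq (var (loc P)) :=
  [seq inr x | x <- params P] ++
  (if ret P is Some r then [:: inr r] else [::]) ++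
  [seq inl g | g <- enum G].

Definition Sum (TC : seq valuation) : form M (inc P) void :=
  FAny [seq FAnd
          (FAll [seq FEq void (Var M (x, 0)) (Lit _ (nu.1 (x, 0)))
                | x <- visible])
          (FAll [seq FEq void (Var M (x, top F x)) (Lit _ (nu.1 (x, top F x)))
                | x <- visible])
       | nu <- TC].

End SSAForm.

Section Sharp.

(* Calls of [q'] in [P] are replaced; [P'] is the procedure [q'] after
   inlining, [F] its single assignment form and [sum] its summary. *)
Variables (P : proc) (q' : name) (P' : proc) (F : ssa P').
Variable sum : form M (inc P') void.

(* Besides the variables of [P] there is a copy of each incarnation for each
   call site (block and position in the block). *)
Definition sharp_loc : eqType := (loc P + (lab P * nat) * inc P')%type.

Definition fresh (site : lab P * nat) (v : inc P') : var sharp_loc :=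
  inr (inr (site, v)).

Definition keep : var (loc P) -> var sharp_loc := var_map inl.

Definition replace (site : lab P * nat) (c : stmt (loc P)) :
    seq (stmt sharp_loc) :=
  match c with
  | Call z q es =>
      if q == q' then
        [seq Assume (FEq void (Var M (fresh site (inr xe.1, 0)))
                              (term_map keep xe.2))
        | xe <- zip (params P') es] ++
        [seq Assume (FEq void (Var M (fresh site (inl g, 0)))
                              (Var M (inl g : var sharp_loc)))
        | g <- enum G] ++
        [:: Assume (form_map (fresh site) id sum)] ++
        [seq Assign (inl g : var sharp_loc)
                    (Var M (fresh site (inl g, top F (inl g))))
        | g <- enum G] ++
        assign_result (omap keep z)
          (omap (fun r => fresh site (inr r, top F (inr r))) (ret P'))
      else [:: stmt_map inl c]
  | _ => [:: stmt_map inl c]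
  end.

Definition replaced (b : lab P) : seq (seq (stmt sharp_loc)) :=
  [seq replace (b, kc.1) kc.2 | kc <- zip (iota 0 (size (body b))) (body b)].

Definition sharp : proc :=
  @Proc sharp_loc [seq inl x | x <- params P] (omap inl (ret P)) (lab P)
    (fun b => flatten (replaced b)) (@edge P) (init P) (final P).

(* The first state and the states after l1, l1 + l2, l1 + l2 + l3 steps, and
   so on, where [ls] lists l1, l2, l3 and so on. *)
Fixpoint milestones (T : Type) (ls : seq nat) (ss : seq T) : seq T :=
  match ls, ss with
  | l :: ls', s :: _ => s :: milestones ls' (drop l ss)
  | _, _ => take 1 ss
  end.

(* The states of an execution of [sharp] along [p], seen as states of [P]. *)
Definition forget (p : seq (lab P)) (ss : seq (state sharp_loc)) :
    seq (state (loc P)) :=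
  [seq (fun x => s (keep x))
  | s <- milestones (shape (flatten [seq replaced b | b <- p])) ss].

End Sharp.

End Programs.

Arguments feasible {M G name} prog P p ss.

(* Main.v *)
(* If B_i holds under a model nu of VC, then nu satisfies the assumptions of
   block i and, unless i = N, some B_j with j a successor of i.  So R_0, which
   means B_0, yields by acyclicity a complete path whose assumptions all hold.
   Reading the current incarnations through nu along this path gives an
   execution of P' from the values v_0 to the values v_n.  Undoing the inlining
   turns it into an execution of the called procedure, which is what a call step
   needs; Sum fixes just the visible values, and these determine the effect of
   the call on the caller. *)

Require Import Defs.
From Stdlib Require List.
From Stdlib Require Import Classical FunctionalExtensionality.
From mathcomp Require Import all_boot.

Set Implicit Arguments.
Unset Strict Implicit.
Unset Printing Implicit Defensive.

(** * Lists and membership *)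

Lemma mem_In (T : eqType) (x : T) (s : seq T) : x \in s -> List.In x s.
Proof.
elim: s => //= y s IH; rewrite inE => /orP[/eqP->|/IH]; by [left | right].
Qed.

Lemma In_map_inv (T U : Type) (f : T -> U) (s : seq T) y :
  List.In y (map f s) -> exists2 x, f x = y & List.In x s.
Proof.
elim: s => //= x s IH [<-|/IH[x' <- x'_s]].
  by exists x => //; left.
by exists x' => //; right.
Qed.

Lemma eq_map_zip (T U V : Type) (f : T -> V) (g : U -> V) xs ys :
  size ys = size xs -> (forall xy, List.In xy (zip xs ys) -> f xy.1 = g xy.2) ->
  map f xs = map g ys.
Proof.
elim: xs ys => [|x xs IH] [|y ys] //= [size_ys] fg.
rewrite (fg (x, y)); last by left.
by congr cons; apply: IH => // xy xy_in; apply: fg; right.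
Qed.

(** * Truth of formulas under renaming, finite conjunctions and [wlp] *)

Section Formulas.

Variable M : structure.

Lemma eval_map V W (h : V -> W) (s : W -> dom M) (t : term M V) :
  eval s (term_map h t) = eval (fun x => s (h x)) t.
Proof.
elim: t => //= f a IH; congr (fint _).
by apply: eq_from_tnth => i; rewrite !tnth_mktuple.
Qed.

Lemma holds_map V W B C (h : V -> W) (k : B -> C) (s : W -> dom M) beta
    (E : form M V B) :
  holds s beta (form_map h k E) =
  holds (fun x => s (h x)) (fun b => beta (k b)) E.
Proof.
elim: E => [||b|r a|t u|E1 IH|E1 IH1 E2 IH2|E1 IH1 E2 IH2|E1 IH1 E2 IH2|E1 IH1 E2 IH2] /=;
  rewrite ?IH ?IH1 ?IH2 //.
  congr (rint _); apply: eq_from_tnth => i.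
  by rewrite !tnth_mktuple eval_map.
by rewrite !eval_map.
Qed.

Lemma holds_FAll V B (s : V -> dom M) (beta : B -> bool) Es :
  holds s beta (FAll Es) -> forall E, List.In E Es -> holds s beta E.
Proof. by elim: Es => //= E Es IH [hE hEs] E1 [<-|/(IH hEs)]. Qed.

Lemma holds_FAll_map V B (s : V -> dom M) (beta : B -> bool) (T : eqType)
    (f : T -> form M V B) (l : seq T) :
  holds s beta (FAll (map f l)) -> forall x, x \in l -> holds s beta (f x).
Proof. by move=> /holds_FAll H x /mem_In ?; apply/H/List.in_map. Qed.

(** Extracts a witness from a negated conjunction of negations, hence the appeal to excluded middle.
    It will produce the successor block with true [BVar]. *)
Lemma not_holds_FAll V B (s : V -> dom M) (beta : B -> bool) (T : eqType)
    (f : T -> form M V B) (l : seq T) :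
  ~ holds s beta (FAll [seq FNot (f x) | x <- l]) ->
  exists2 x, x \in l & holds s beta (f x).
Proof.
elim: l => [|x l IH] /=; first by case.
move=> H; case: (classic (holds s beta (f x))) => hx.
  by exists x; rewrite // inE eqxx.
have [|y y_l hy] := IH; first by move=> ?; apply: H.
by exists y; rewrite // inE y_l orbT.
Qed.

Lemma holds_FAny_map V B (s : V -> dom M) (beta : B -> bool) (T : Type)
    (f : T -> form M V B) (l : seq T) :
  holds s beta (FAny (map f l)) -> exists2 x, List.In x l & holds s beta (f x).
Proof.
elim: l => //= x l IH [hx|/IH[y y_l hy]]; first by exists x => //; left.
by exists y => //; right.
Qed.

(** [wlp] of assumptions is a chain of implications; classically such a chain fails only if all
    premises are true and the conclusion is false. *)
Lemma not_holds_wlp V B (s : V -> dom M) (beta : B -> bool) S Q :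
  ~ holds s beta (wlp S Q) ->
  (forall E : form M V B, List.In E S -> holds s beta E) /\ ~ holds s beta Q.
Proof.
elim: S => [|E S IH] /=; first by [].
move=> H; have [hE /IH[hS hQ]] := imply_to_and _ _ H.
by split=> // E' [<-|/hS].
Qed.

End Formulas.

(** * Acyclic graphs and rank functions *)

(* A rank function is easier to carry through inlining than acyclicity. *)
Definition ranked (T : Type) (e : rel T) : Prop :=
  exists r : T -> nat, forall x y, e x y -> r y < r x.

(** The rank of a vertex is the number of vertices reachable from it. Along an edge from x to y it
    drops strictly, because x is no longer reachable: a path from y back to x would close a
    cycle. *)
Lemma acyclic_ranked (T : finType) (e : rel T) :
  (forall p : seq T, cycle e p -> p = [::]) -> ranked e.
Proof.
move=> acyclic; exists (fun x => #|connect e x|) => x y exy.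
apply: proper_card; apply/properP; split.
  apply/subsetP => z; apply: connect_trans; exact: connect1.
exists x; first exact: connect0.
apply/negP => /connectP[p e_p x_last].
have: path e x (y :: p) by rewrite /= exy.
by rewrite lastI -x_last => /(acyclic (x :: belast y p)).
Qed.

(** * Steps, and runs with their intermediate states hidden *)

Section Simulation.

Variables (M : structure) (G : finType) (name : eqType).
Variable prog : name -> proc M G name.

Local Notation step P := (@step M G name prog P).
Local Notation steps P := (@steps M G name prog P).

Definition pull (L L' : Type) (h : L -> L') (s : state M G L') : state M G L :=
  fun x => s (var_map h x).

Lemma var_map_inj (L L' : Type) (h : L -> L') :
  injective h -> injective (var_map h : var G L -> var G L').
Proof. by move=> h_inj [g|x] [g'|x'] //= [] => [->|/h_inj->]. Qed.

Lemma pull_upd (L L' : eqType) (h : L -> L') (s : state M G L') x d :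
  injective h -> pull h (upd s (var_map h x) d) = upd (pull h s) x d.
Proof.
move=> h_inj; apply: functional_extensionality => y.
by rewrite /pull /upd (inj_eq (var_map_inj h_inj)).
Qed.

Lemma pull_after_call (L L' : eqType) (h : L -> L') (Q : proc M G name) z s
    (t : state M G (loc Q)) :
  injective h ->
  pull h (after_call (omap (var_map h) z) s t) = after_call z (pull h s) t.
Proof.
move=> h_inj; rewrite /after_call; case: z => [x|] /=; case: (ret Q) => [r|].
- by rewrite pull_upd //; congr upd; apply: functional_extensionality => -[].
all: by apply: functional_extensionality => -[].
Qed.

Lemma step_inv (P : proc M G name) c s s' : step P c s s' ->
  match c with
  | Assign x e => s' = upd s x (eval s e)
  | Assume E => s' = s /\ holds s (of_void bool) E
  | Call z q es => exists p t ts,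
      [/\ feasible prog (prog q) p (t :: ts),
          [seq t (inr x) | x <- params (prog q)] = [seq eval s e | e <- es],
          (forall g, t (inl g) = s (inl g)) &
          s' = after_call z s (last t ts)]
  end.
Proof. by case=> // z q es {}s p t ts *; exists p, t, ts. Qed.

Lemma steps_inv (P : proc M G name) cs ss : steps P cs ss ->
  if cs is c :: cs' then exists s s' ss',
    [/\ ss = [:: s, s' & ss'], step P c s s' & steps P cs' (s' :: ss')]
  else exists s, ss = [:: s].
Proof.
by case=> [s|c {}cs s s' {}ss *]; [exists s | exists s, s', ss].
Qed.

(** Only the end states of an execution of the callee matter to a call, so the states in between are
    quantified away. This makes executions compose like relations. *)
Definition run (P : proc M G name) cs s s' : Prop :=
  exists2 ss, steps P cs (s :: ss) & last s ss = s'.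
Arguments run : clear implicits.

Lemma run_nil (P : proc M G name) s s' : run P [::] s s' <-> s' = s.
Proof.
split; first by case=> ss /steps_inv[_ [_ ->]] /= ->.
by move=> ->; exists [::] => //; constructor.
Qed.

Lemma run_cons (P : proc M G name) c cs s s' :
  run P (c :: cs) s s' <-> exists2 m, step P c s m & run P cs m s'.
Proof.
split=> [[ss /steps_inv[_ [m [ss' [[<- ->] sm ms]]]] /= l]|[m sm [ss ms l]]].
  by exists m => //; exists ss'.
by exists (m :: ss) => //; constructor.
Qed.

Lemma run_cat (P : proc M G name) cs1 cs2 s s' :
  run P (cs1 ++ cs2) s s' <-> exists2 m, run P cs1 s m & run P cs2 m s'.
Proof.
elim: cs1 s => [|c cs IH] s /=.
  split=> [?|[m /run_nil->] //]; by exists s => //; apply/run_nil.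
rewrite run_cons; split=> [[m sm /IH[m' mm' ?]]|[m' /run_cons[m sm mm'] m's']].
  by exists m' => //; apply/run_cons; exists m.
by exists m => //; apply/IH; exists m'.
Qed.

Lemma run_seq1 (P : proc M G name) c s s' :
  run P [:: c] s s' <-> step P c s s'.
Proof.
rewrite run_cons; split=> [[m sm /run_nil->] //|?].
by exists s' => //; apply/run_nil.
Qed.

Lemma run_Assume_map (P : proc M G name) T (f : T -> form M _ void) l s s' :
  run P [seq Assume name (f x) | x <- l] s s' ->
  s' = s /\ forall x, List.In x l -> holds s (of_void bool) (f x).
Proof.
elim: l => [/run_nil //|x l IH /= /run_cons[m /step_inv[-> hx] /IH[-> hl]]].
by split=> // y [<-|/hl].
Qed.

Lemma run_assign_result (P : proc M G name) z r s s' :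
  run P (assign_result M name z r) s s' ->
  s' = match z, r with Some x, Some y => upd s x (s y) | _, _ => s end.
Proof.
case: z => [x|]; case: r => [y|] /=; try by move/run_nil.
by move=> /run_seq1/step_inv.
Qed.

(** * Renamed statements and the segments of an inlined call *)

(** The second conclusion is a frame property: a renamed statement cannot touch non-global variables
    outside the image of [h]. It later shows that the inlined callee preserves the locals of the
    caller. *)
Lemma step_map (P P1 : proc M G name) (h : loc P -> loc P1) c s s' :
  injective h -> step P1 (stmt_map h c) s s' ->
  step P c (pull h s) (pull h s') /\
  forall y, (forall x, h x != y) -> s' (inr y) = s (inr y).
Proof.
move=> h_inj; case: c => [x e|E|z q es] /= /step_inv.
- move=> ->; rewrite pull_upd // eval_map; split; first exact: StepAssign.
  move=> y hy; rewrite /upd; case: eqP => // y_x.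
  by case: x y_x => //= x [y_x]; have := hy x; rewrite y_x eqxx.
- by rewrite holds_map => -[-> hE]; split=> //; apply: StepAssume.
case=> p [t [ts [Q_t t_es t_g ->]]]; split.
  rewrite pull_after_call //; apply: StepCall Q_t _ t_g.
  by rewrite t_es -map_comp; apply: eq_map => e /=; rewrite eval_map.
move=> y hy; rewrite /after_call.
case: z => [x|] //=; case: ret => // r; rewrite /upd.
case: eqP => // y_x.
by case: x y_x => //= x [y_x]; have := hy x; rewrite y_x eqxx.
Qed.

Lemma run_map (P P1 : proc M G name) (h : loc P -> loc P1) cs s s' :
  injective h -> run P1 (map (stmt_map h) cs) s s' ->
  run P cs (pull h s) (pull h s') /\
  forall y, (forall x, h x != y) -> s' (inr y) = s (inr y).
Proof.
move=> h_inj; elim: cs s => [s /run_nil->|c cs IH s /run_cons[m]] /=.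
  by split=> //; apply/run_nil.
move=> /(step_map h_inj)[sm sm_y] /IH[ms' ms'_y]; split.
  by apply/run_cons; exists (pull h m).
by move=> y hy; rewrite ms'_y ?sm_y.
Qed.

(** Assigning the parameters one after another has the effect of simultaneous binding: the arguments
    mention only globals and caller variables, which these assignments do not change. The second
    conclusion serves the induction: as [xs] has no repetitions, the first parameter survives the
    later assignments. *)
Lemma run_params (P1 : proc M G name) (L K : eqType) (hp : L -> loc P1)
    (hq : K -> loc P1) (xs : seq K) (es : seq (term M (var G L))) s s' :
  injective hq -> (forall x y, hp x != hq y) ->
  uniq xs -> size es = size xs ->
  run P1 [seq Assign name (inr (hq xe.1) : var G _)
                     (term_map (var_map hp) xe.2) | xe <- zip xs es] s s' ->
  [/\ pull hp s' = pull hp s,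
      forall y, y \notin xs -> s' (inr (hq y)) = s (inr (hq y)) &
      [seq s' (inr (hq x)) | x <- xs] = [seq eval (pull hp s) e | e <- es]].
Proof.
move=> hq_inj hpq.
elim: xs es s => [|x xs IH] [|e es] s //= => [_ _ /run_nil -> //|].
move=> /andP[x_xs xs_uniq] [es_size] /run_cons[m /step_inv m_def].
have pull_m : pull hp m = pull hp s.
  apply: functional_extensionality => -[g|y]; rewrite m_def /pull /upd //=.
  by case: eqP => // -[/eqP]; rewrite (negPf (hpq _ _)).
case/IH=> // pull_s' s'_out ->; rewrite pull_s' pull_m; split=> //.
  move=> y; rewrite inE negb_or => /andP[y_x /s'_out->].
  rewrite m_def /upd; case: eqP => // -[/hq_inj] /eqP.
  by rewrite (negPf y_x).
by rewrite s'_out // m_def /upd eqxx eval_map.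
Qed.

(** The three runs belong to the pieces into which inlining cuts the block. The callee starts in
    [pull hq s1]; a call step leaves its other variables arbitrary, so whatever [s1] holds there is
    allowed. *)
Lemma run_inlined_call (P P1 : proc M G name) q (hp : loc P -> loc P1)
    (hq : loc (prog q) -> loc P1) pre z es post p s s1 s2 s' :
  injective hp -> injective hq -> (forall x y, hp x != hq y) ->
  uniq (params (prog q)) -> size es = size (params (prog q)) ->
  complete_path p ->
  run P1 (map (stmt_map hp) pre ++
          [seq Assign name (inr (hq xe.1) : var G _)
                      (term_map (var_map hp) xe.2)
          | xe <- zip (params (prog q)) es]) s s1 ->
  run P1 (map (stmt_map hq) (stmts_along p)) s1 s2 ->
  run P1 (assign_result M name (omap (var_map hp) z)
            (omap (fun r => inr (hq r)) (ret (prog q))) ++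
          map (stmt_map hp) post) s2 s' ->
  run P (pre ++ Call z q es :: post) (pull hp s) (pull hp s').
Proof.
move=> hp_inj hq_inj hpq xs_uniq es_size p_complete.
case/run_cat=> m /(run_map hp_inj)[pre_run _].
case/(run_params hq_inj hpq xs_uniq es_size)=> m_s1 _ s1_es.
case/(run_map hq_inj)=> -[ts q_steps q_last] s2_s1.
case/run_cat=> m' /run_assign_result m'_def /(run_map hp_inj)[post_run _].
apply/run_cat; exists (pull hp m) => //; apply/run_cons.
exists (pull hp m') => //.
suff -> : pull hp m' = after_call z (pull hp m) (last (pull hq s1) ts).
  apply: StepCall; first exact: Feasible q_steps.
    exact: s1_es.
  by move=> g; have := congr1 (@^~ (inl g)) m_s1.
(* The caller's locals pass unchanged through the callee's body and the parameter assignments. *)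
have s2_m x : s2 (inr (hp x)) = m (inr (hp x)).
  rewrite s2_s1; last by move=> y; rewrite eq_sym hpq.
  by have := congr1 (@^~ (inr x)) m_s1.
rewrite m'_def q_last -m_s1 /after_call.
case: z {m'_def post_run} => [x|] /=; case: (ret (prog q)) => [r|] /=.
- rewrite pull_upd //; congr upd.
  by apply: functional_extensionality => -[//|y]; rewrite m_s1; apply: s2_m.
all: apply: functional_extensionality => -[//|y]; rewrite m_s1; apply: s2_m.
Qed.

Lemma stmts_along_cat (P : proc M G name) (p1 p2 : seq (lab P)) :
  stmts_along (p1 ++ p2) = stmts_along p1 ++ stmts_along p2.
Proof. by rewrite /stmts_along map_cat flatten_cat. Qed.

(** * Undoing a single inlining *)

Section Inline.

Variables (P : proc M G name) (q : name) (b : lab P).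
Variables (z : option (var G (loc P))) (es : seq (term M (var G (loc P)))).
Variables pre post : seq (stmt M G name (loc P)).

Let Q := prog q.
Let I := inline_call Q b pre z es post.
Let callee (c : lab Q) : lab I := Some (inr c).

(** The only exit from the callee's blocks is the edge from [final Q] to [None], and no callee block
    is final in [I]. So a path to the end splits at its first visit to [None]. *)
Lemma inline_path_callee (d : lab Q) (u : seq (lab I)) :
  path (@edge _ _ _ I) (callee d) u -> last (callee d) u = final I ->
  exists p u', [/\ u = map callee p ++ None :: u', path (@edge _ _ _ Q) d p,
    last d p = final Q, path (@edge _ _ _ I) None u' & last None u' = final I].
Proof.
elim: u d => [|x u IH] d; first by rewrite /=; case: ifP.
case: x => [[c|c]|] //= /andP[de u_path] u_last.
  have [p [u' [-> p_path p_last u'_path u'_last]]] := IH _ u_path u_last.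
  by exists (c :: p), u'; rewrite /= de.
by exists [::], u; rewrite (eqP de).
Qed.

Lemma stmts_along_callee (p : seq (lab Q)) :
  stmts_along (map callee p) = map (stmt_map inr) (stmts_along p).
Proof. by elim: p => //= c p IH; rewrite map_cat -IH. Qed.

Hypothesis b_body : body b = pre ++ Call z q es :: post.

Lemma inline_run (c : lab P) (u : seq (lab I)) s s' :
  uniq (params Q) -> size es = size (params Q) ->
  path (@edge _ _ _ I) (Some (inl c)) u ->
  last (Some (inl c) : lab I) u = final I ->
  run I (stmts_along ((Some (inl c) : lab I) :: u)) s s' ->
  exists p, [/\ path (@edge _ _ _ P) c p, last c p = final P &
                run P (stmts_along (c :: p)) (pull inl s) (pull inl s')].
Proof.
move=> xs_uniq es_size.
have inl_inj : injective (inl : loc P -> loc I) by move=> ? ? [].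
have inr_inj : injective (inr : loc Q -> loc I) by move=> ? ? [].
have run_along x (v : seq (lab I)) t t' : run I (stmts_along (x :: v)) t t' ->
    exists2 m, run I (body x) t m & run I (stmts_along v) m t'.
  by move/run_cat.
have [n] := ubnP (size u); elim: n => // n IH in c u s *.
rewrite ltnS => u_n u_path u_last; have [c_b|c_b] := eqVneq c b.
  (* The path cannot stop at the block keeping [pre]: if [b] is final in [P], then the final block
     of [I] is [None]. *)
  case: u u_path u_last u_n => [_|x u].
    by rewrite /= c_b; case: eqP => // nb [/esym].
  case: x => [[d|d]|] //= /andP[]; rewrite c_b eqxx //=.
  move=> /eqP-> /inline_path_callee H /H[p [u' [-> p_path p_last]]].
  move=> u'_path u'_last u_n.
  case/run_along=> s1 /=; rewrite eqxx => run1.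
  rewrite -(cat_cons (callee (init Q)) (map callee p)) -map_cons.
  rewrite stmts_along_cat stmts_along_callee => /run_cat[s2 run2].
  case/run_along=> s3 run3 run4.
  have p_complete : complete_path (init Q :: p).
    by rewrite /complete_path /= eqxx p_path p_last eqxx.
  have b_run : run P (body b) (pull inl s) (pull inl s3).
    rewrite b_body.
    by apply: (run_inlined_call inl_inj inr_inj _ xs_uniq es_size p_complete
                run1 run2) run3.
  (* After [None] the path either ends, and then [b] is final in [P], or continues with a successor
     of [b] in [P]. *)
  case: u' u'_path u'_last u_n run4 => [_|x u'] /=.
    case: eqP => // b_final _ _ /run_nil->; exists [::]; split=> //.
    by rewrite /stmts_along /= cats0.
  case: x => [[d'|d']|] //= /andP[bd u'_path] u'_last u_n run4.
  have [|p' [p'_path p'_last p'_run]] := IH d' u' s3 _ u'_path u'_last run4.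
    apply: leq_ltn_trans u_n; rewrite size_cat /= !addnS.
    by apply/leqW/leqW; apply: leq_addl.
  exists (d' :: p'); split=> //=; first by rewrite bd.
  by apply/run_cat; exists (pull inl s3).
case: u u_path u_last u_n => [_|x u] /=.
  case: eqP => // _ [c_final] _; rewrite /stmts_along /= (negPf c_b) cats0.
  move=> /(run_map inl_inj)[? _]; exists [::]; split=> //.
  by rewrite /stmts_along /= cats0.
case: x => [[d|d]|] //=; rewrite ?(negPf c_b) //= => /andP[cd u_path] u_last u_n.
case/run_along=> m /=; rewrite (negPf c_b) => /(run_map inl_inj)[run1 _] run2.
have [p [p_path p_last p_run]] := IH d u m u_n u_path u_last run2.
exists (d :: p); split=> //=; first by rewrite cd.
by apply/run_cat; exists (pull inl m).
Qed.

(** Each block of [P] gets an interval of [K] ranks, ordered by [rP]. Blocks of [P] sit at the top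
    of their interval; within that of [b], the callee's blocks lie below the top and [None] is at
    the bottom. *)
Lemma inline_ranked :
  ranked (@edge _ _ _ P) -> ranked (@edge _ _ _ Q) -> ranked (@edge _ _ _ I).
Proof.
(* The callee uses the offsets from 1 to the maximum of [rQ] plus 1; adding 3 to the maximum leaves
   room for 0 below and for [K.-1] above. *)
case=> rP rP_edge [rQ rQ_edge]; pose K := (\max_c rQ c).+3.
have rQ_K c : rQ c <= \max_d rQ d by apply: leq_bigmax.
exists (fun x => match x with
          | Some (inl c) => rP c * K + K.-1
          | Some (inr c) => rP b * K + (rQ c).+1
          | None => rP b * K
        end).
have rP_K c d : rP d < rP c -> rP d * K + K.-1 < rP c * K.
  move=> lt_dc.
  have: (rP d).+1 * K <= rP c * K by rewrite leq_mul2r lt_dc orbT.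
  by apply: leq_trans; rewrite mulSn addnC ltn_add2r.
case=> [[c|c]|] [[d|d]|] //=.
- move=> /andP[_ /rP_edge/rP_K lt]; apply: leq_trans lt _; exact: leq_addr.
- by move=> /andP[/eqP-> _]; rewrite ltn_add2l /= !ltnS.
- by move=> /rQ_edge ?; rewrite ltn_add2l.
- by move=> _; rewrite addnS ltnS leq_addr.
- by move=> /rP_edge/rP_K.
Qed.

End Inline.

(** * Well-formed calls and repeated inlining *)

(** The clause of [wf_proc] about calls, phrased by list membership; it is an invariant of
    inlining. *)
Definition wf_body (P : proc M G name) : Prop :=
  forall (b : lab P) c, List.In c (body b) -> wf_call prog c.

Lemma wf_proc_body P : wf_proc prog P -> wf_body P.
Proof.
case=> _ _ wf b c c_b; have [pre [post b_body]] := List.in_split _ _ c_b.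
exact: wf b_body.
Qed.

Lemma wf_call_map L L' (h : L -> L') (c : stmt M G name L) :
  wf_call prog c -> wf_call prog (stmt_map h c).
Proof. by case: c => //= -[x|] q es; rewrite size_map. Qed.

Lemma wf_assign_result L (z r : option (var G L)) c :
  List.In c (assign_result M name z r) -> wf_call prog c.
Proof. by case: z => [x|] //; case: r => [y|] //= [<-|]. Qed.

Lemma inline_wf_body (P : proc M G name) q (b : lab P) pre z es post :
  body b = pre ++ Call z q es :: post ->
  wf_body P -> wf_body (prog q) ->
  wf_body (inline_call (prog q) b pre z es post).
Proof.
move=> b_body wfP wfQ [[c|c]|] d /=.
- case: ifP => _ d_in; last first.
    by have [d' <- d'_c] := In_map_inv d_in; apply/wf_call_map/(wfP c).
  have [{}d_in|{}d_in] := List.in_app_or _ _ _ d_in.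
    have [d' <- d'_pre] := In_map_inv d_in; apply/wf_call_map/(wfP b).
    by rewrite b_body; apply: List.in_or_app; left.
  by have [d' <- _] := In_map_inv d_in.
- move=> d_in; have [d' <- d'_c] := In_map_inv d_in.
  exact/wf_call_map/(wfQ c).
move=> d_in; have [|{}d_in] := List.in_app_or _ _ _ d_in.
  exact: wf_assign_result.
have [d' <- d'_post] := In_map_inv d_in; apply/wf_call_map/(wfP b).
by rewrite b_body; apply: List.in_or_app; right; right.
Qed.

(** Induction on the inlinings: the rank is carried forward to [P1], and runs are carried back to
    [P]. The renaming [h] collects one [inl] for each inlined call. *)
Lemma inlines_run (P P1 : proc M G name) :
  wf_prog prog -> inlines prog P P1 -> wf_body P -> ranked (@edge _ _ _ P) ->
  exists h : loc P -> loc P1,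
    [/\ params P1 = map h (params P), ret P1 = omap h (ret P),
        ranked (@edge _ _ _ P1) &
        forall (p : seq (lab P1)) s s', complete_path p ->
          run P1 (stmts_along p) s s' ->
        exists2 p0 : seq (lab P), complete_path p0 &
          run P (stmts_along p0) (pull h s) (pull h s')].
Proof.
move=> wf; elim=> {P P1} [P wfP rP|P P1 b pre z q es post b_body q_acyclic _ IH
                          wfP rP].
  exists id; split; rewrite ?map_id //; first by case: (ret P).
  have pull_id (s : state M G (loc P)) : pull id s = s.
    by apply: functional_extensionality => -[].
  by move=> p s s' ? ?; exists p; rewrite // !pull_id.
have [] := IH; first exact: inline_wf_body (wf_proc_body (wf q)).
  by apply: inline_ranked => //; apply: acyclic_ranked.
move=> h [params_h ret_h rP1 P1_run]; exists (h \o inl); split=> //.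
- by rewrite params_h -map_comp.
- by rewrite ret_h /=; case: (ret P).
move=> p s s' p_complete p_run.
have [[//|x u] /and3P[/eqP-> u_path /eqP u_last] u_run] :=
  P1_run p s s' p_complete p_run.
have [xs_uniq _ _] := wf q.
have [es_size _] : wf_call prog (Call z q es).
  by apply: (wfP b); rewrite b_body; apply: List.in_elt.
have [p0 [p0_path p0_last p0_run]] :=
  inline_run b_body xs_uniq es_size u_path u_last u_run.
exists (init P :: p0).
  by rewrite /complete_path /= eqxx p0_path p0_last eqxx.
have pull_pull t : pull (h \o inl) t = pull inl (pull h t).
  by apply: functional_extensionality => -[].
by rewrite !pull_pull.
Qed.

(** * From a model of the verification condition to a run *)

Section SingleAssignment.

Variables (P : proc M G name) (F : ssa P) (nu : valuation F).
Hypotheses (F_ssa : ssa_form F) (nu_VC : holds nu.1 nu.2 (VC F)).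

Let at_incs (i : var G (loc P) -> nat) : state M G (loc P) :=
  fun x => nu.1 (x, i x).

(* [nu] gives each incarnation one value, so reading the current incarnations
   through [nu] yields the state; a copy does not change it. *)
Lemma passive_run i cs S w j :
  @passive M G name P (N F).+1 i cs S w j ->
  (forall E, List.In E S -> holds nu.1 nu.2 E) ->
  run P cs (at_incs i) (at_incs j).
Proof.
have set_incE i' x k (d : dom M) : nu.1 (x, k) = d ->
    at_incs (set_inc i' x k) = upd (at_incs i') x d.
  move=> <-; apply: functional_extensionality => y.
  by rewrite /at_incs /set_inc /upd; case: eqP => // ->.
elim=> {i cs S w j} [i|i x k S w j _ IH|i E cs S w j _ IH|
                     i x e k cs S w j _ IH] hS.
- exact/run_nil.
- have copy : at_incs (set_inc i x k) = at_incs i.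
    rewrite (set_incE i x k _ (hS _ (or_introl erefl))).
    by apply: functional_extensionality => y; rewrite /upd; case: eqP => // ->.
  by rewrite -copy; apply: IH => E E_S; apply: hS; right.
- apply/run_cons; exists (at_incs i).
    have := hS _ (or_introl erefl); rewrite holds_map => hE.
    apply: StepAssume; congr (holds _ _ _): hE.
    by apply: functional_extensionality => -[].
  by apply: IH => E' E_S; apply: hS; right.
apply/run_cons; exists (at_incs (set_inc i x k)).
  rewrite (set_incE i x k (eval (at_incs i) e)); first exact: StepAssign.
  by have /= := hS _ (or_introl erefl); rewrite eval_map.
by apply: IH => E E_S; apply: hS; right.
Qed.

(** The negated [wlp] in the clause for [i] yields both the assumptions of the block and, except for
    the last block, a successor whose [BVar] is true. *)
Lemma block_run i : nu.2 (BVar i) ->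
  run P (ssa_source (blk i)) (at_incs (inc_in i)) (at_incs (inc_out i)) /\
  (i = ord_max \/ exists2 j, ssa_edge i j & nu.2 (BVar j)).
Proof.
move=> Bi; case: nu_VC => inner [final_block _].
have [i_max|i_max] := eqVneq i ord_max.
  move: final_block; rewrite -i_max => -[/(_ Bi) /not_holds_wlp[hS _] _].
  by split; [exact: passive_run (ssa_passive F_ssa i) hS | left].
have i_N : i < N F.
  by rewrite ltn_neqAle -ltnS ltn_ord andbT; apply: contra i_max => /eqP ?;
    apply/eqP/val_inj.
have i_in : i \in [seq j : 'I_(N F).+1 <- enum 'I_(N F).+1 | j < N F].
  by rewrite mem_filter i_N mem_enum.
have [/(_ Bi) /not_holds_wlp[hS hQ] _] := holds_FAll_map inner i_in.
split; first exact: passive_run (ssa_passive F_ssa i) hS.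
right; have [j] := not_holds_FAll hQ.
by rewrite mem_filter => /andP[? _] ?; exists j.
Qed.

(** Induction on the rank of the block of [P]. Equal incarnations across an edge, by [ssa_flow], let
    the runs of consecutive blocks be joined. *)
Lemma ssa_run_from b i : ranked (@edge _ _ _ P) ->
  blk i = inl b -> nu.2 (BVar i) ->
  exists p, [/\ path (@edge _ _ _ P) b p, last b p = final P &
    run P (stmts_along (b :: p)) (at_incs (inc_in i)) (at_incs (top F))].
Proof.
case=> r r_edge; have [n] := ubnP (r b); elim: n => // n IH in b i *.
rewrite ltnS => b_n b_i /block_run[].
have out_in (j k : 'I_(N F).+1) : ssa_edge j k -> at_incs (inc_out j) = at_incs (inc_in k).
  move=> jk; apply: functional_extensionality => x.
  by rewrite /at_incs (ssa_flow F_ssa jk).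
rewrite b_i /= => run_b [i_max|[j ij Bj]].
  exists [::]; move: b_i run_b; rewrite i_max (ssa_final F_ssa) => -[<-] run_b.
  split=> //; rewrite /stmts_along /= cats0.
  congr (run P _ _ _): run_b; apply: functional_extensionality => x.
  by rewrite /at_incs (ssa_exit F_ssa).
(* The successor [j] may be a block splitting an edge. It has no source statements, so its copies
   leave the state as it is, and it is not final, so one further successor is again a block of
   [P]. *)
have [d [k [bd d_k Bk run_d]]] : exists d (k : 'I_(N F).+1), [/\ edge b d, blk k = inl d,
    nu.2 (BVar k) & at_incs (inc_out i) = at_incs (inc_in k)].
  have := ij; rewrite {1}/ssa_edge b_i.
  case j_blk: (blk j) => [d|[b' d]].
    by move=> /andP[bd _]; exists d, j; split=> //; exact: out_in.
  move=> /eqP b_b'; subst b'; have [] := block_run Bj.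
  rewrite j_blk => /run_nil run_j.
  case=> [j_max|[k jk Bk]].
    by move: j_blk; rewrite j_max (ssa_final F_ssa).
  have /andP[bd _] : ssa_block F (inr (b, d)).
    by apply/(ssa_blk_im F_ssa); exists j.
  have := jk; rewrite {1}/ssa_edge j_blk.
  case k_blk: (blk k) => [c|[]] // /eqP d_c.
  exists d, k; split=> //; first by rewrite k_blk d_c.
  by rewrite (out_in _ _ ij) -run_j; exact: out_in.
have [|//|//|p [p_path p_last p_run]] := IH d k.
  exact: leq_trans (r_edge _ _ bd) b_n.
exists (d :: p); split=> //=; first by rewrite bd.
by apply/run_cat; exists (at_incs (inc_in k)); rewrite // -run_d.
Qed.

Lemma ssa_run : ranked (@edge _ _ _ P) -> nu.2 (RVar ord0) ->
  exists2 p : seq (lab P), complete_path p &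
    run P (stmts_along p) (fun x => nu.1 (x, 0)) (fun x => nu.1 (x, top F x)).
Proof.
move=> rP R0; have B0 : nu.2 (BVar ord0).
  by case: nu_VC => _ [_ [[/(_ R0)]]].
have [p [p_path p_last p_run]] := ssa_run_from rP (ssa_init F_ssa) B0.
exists (init P :: p); first by rewrite /complete_path /= eqxx p_path p_last eqxx.
congr (run P _ _ _): p_run; apply: functional_extensionality => x.
by rewrite /at_incs (ssa_entry F_ssa).
Qed.

End SingleAssignment.

(** * Grouping steps into chunks *)

(** There is one state more than there are statements, so dropping [size cs1] states leaves the
    state between the two parts at the head. *)
Lemma steps_cat_inv (P : proc M G name) cs1 cs2 ss :
  steps P (cs1 ++ cs2) ss ->
  exists s s' ss1 ss2, [/\ ss = s :: ss1, drop (size cs1) ss = s' :: ss2,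
    run P cs1 s s' & steps P cs2 (s' :: ss2)].
Proof.
elim: cs1 ss => [|c cs IH] ss /=.
  case: cs2 => [|c cs]; move=> H; have := steps_inv H.
    case=> s ss_s; exists s, s, [::], [::].
    by rewrite -ss_s drop0; split=> //; apply/run_nil.
  case=> s [s' [ss' [ss_s _ _]]]; exists s, s, (s' :: ss'), (s' :: ss').
  by rewrite -ss_s drop0; split=> //; apply/run_nil.
case/steps_inv=> s [m [ss' [-> sm]]].
move=> /IH[_ [s' [ss1 [ss2 [[<- _] ss2_def run_cs ?]]]]].
exists s, s', (m :: ss'), ss2; split=> //.
by apply/run_cons; exists m.
Qed.

(** If every chunk acts like a single step of [P], the states at the chunk boundaries form an
    execution of [P]. *)
Lemma steps_milestones (P P1 : proc M G name) (h : loc P -> loc P1) cs chunks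
    ss :
  List.Forall2 (fun c ch => forall s s',
    run P1 ch s s' -> step P c (pull h s) (pull h s')) cs chunks ->
  steps P1 (flatten chunks) ss ->
  steps P cs [seq pull h s | s <- milestones (shape chunks) ss].
Proof.
move=> cs_chunks.
elim: cs_chunks ss => {cs chunks} [|c ch cs chunks c_ch _ IH] ss.
  by move=> /steps_inv[s ->]; constructor.
case/steps_cat_inv=> s [s' [ss1 [ss2 [-> /= -> /c_ch c_step /IH]]]].
(* The list of milestones starts with [s'] also when no chunk is left, so the next step can be
   attached to it. *)
have [ms ->] : exists ms, milestones (shape chunks) (s' :: ss2) = s' :: ms.
  by case: (shape chunks) => [|l ls]; eexists.
by move=> /=; apply: StepsCons.
Qed.

(** The sources are not global, so no assignment affects what a later one reads. *)
Lemma run_assign_globals (P : proc M G name) (f : G -> loc P) gs s s' :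
  run P [seq Assign name (inl g : var G (loc P)) (Var M (inr (f g))) | g <- gs]
      s s' ->
  (forall y, s' (inr y) = s (inr y)) /\
  (forall g, s' (inl g) = if g \in gs then s (inr (f g)) else s (inl g)).
Proof.
elim: gs s => [s /run_nil-> //|g gs IH s].
case/run_cons=> m /step_inv m_def /IH[s'_l s'_g].
split=> [y|g']; first by rewrite s'_l m_def.
rewrite s'_g inE m_def /upd /=; case: ifP => _; first by rewrite orbT.
by rewrite orbF; case: eqP => [[->]|]; case: eqP => // ->.
Qed.

(** * Replacing calls by the summary *)

Section Sharp.

Variables (P : proc M G name) (q : name) (P' : proc M G name) (F : ssa P').
Variable TC : seq (valuation F).
Variable h : loc (prog q) -> loc P'.

Hypothesis F_ssa : ssa_form F.
Hypothesis TC_sat : forall nu : valuation F, List.In nu TC ->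
  holds nu.1 nu.2 (VC F) /\ nu.2 (RVar ord0) = true.
Hypothesis P'_ranked : ranked (@edge _ _ _ P').
Hypothesis params_h : params P' = map h (params (prog q)).
Hypothesis ret_h : ret P' = omap h (ret (prog q)).
Hypothesis P'_run : forall (p : seq (lab P')) s s', complete_path p ->
  run P' (stmts_along p) s s' ->
  exists2 p0 : seq (lab (prog q)), complete_path p0 &
    run (prog q) (stmts_along p0) (pull h s) (pull h s').

Let P_sharp := @sharp M G name P q P' F (Sum TC).

(** The true disjunct of [Sum TC] comes from some [nu], whose values form a run of [P'] and hence of
    the called procedure. The disjunct ties [s] to [nu] on the visible variables only. *)
Lemma Sum_run (s : inc P' -> dom M) beta : holds s beta (Sum TC) ->
  exists (t t' : state M G (loc P')) (p : seq (lab (prog q))),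
    [/\ complete_path p,
        run (prog q) (stmts_along p) (pull h t) (pull h t') &
        forall x, x \in visible P' -> t x = s (x, 0) /\ t' x = s (x, top F x)].
Proof.
case/holds_FAny_map=> nu /TC_sat[nu_VC R0] [/holds_FAll_map eq0 /holds_FAll_map eqn].
have [p' p'_complete /(P'_run p'_complete)[p p_complete p_run]] :=
  ssa_run F_ssa nu_VC P'_ranked R0.
exists (fun x => nu.1 (x, 0)), (fun x => nu.1 (x, top F x)), p; split=> // x x_V.
by have /= <- := eq0 _ x_V; have /= <- := eqn _ x_V.
Qed.

(** Agreement on visible variables suffices: a call passes in parameters and globals, and passes out
    globals and the result. The remaining initial values of the callee are arbitrary and are taken
    from the run given by [Sum_run]. *)
Lemma replace_run site c s s' : wf_call prog c ->
  run P_sharp (replace q F (Sum TC) site c) s s' ->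
  step P c (pull inl s) (pull inl s').
Proof.
have inl_inj : injective (inl : loc P -> loc P_sharp) by move=> ? ? [].
case: c => [x e|E|z q1 es].
- by move=> _ /run_seq1/(step_map inl_inj)[].
- by move=> _ /run_seq1/(step_map inl_inj)[].
rewrite /replace; case: eqP => [-> {q1}|_ _]; last first.
  by move=> /run_seq1/(step_map inl_inj)[].
case=> es_size _.
case/run_cat=> _ /run_Assume_map[-> s_es].
case/run_cat=> _ /run_Assume_map[-> s_g].
case/run_cat=> _ /run_seq1/step_inv[-> s_Sum].
case/run_cat=> m /run_assign_globals[m_l m_g] /run_assign_result s'_def.
move: s_Sum; rewrite holds_map.
case/Sum_run=> t [t' [p [p_complete [ts p_steps p_last] t_s]]].
have visible_param x : x \in params (prog q) -> inr (h x) \in visible P'.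
  move=> x_q; rewrite mem_cat; apply/orP; left.
  by apply/map_f; rewrite params_h; apply: map_f.
have visible_global g : inl g \in visible P'.
  by rewrite !mem_cat (map_f inl) ?mem_enum // !orbT.
have visible_ret r : ret (prog q) = Some r -> inr (h r) \in visible P'.
  by move=> r_q; rewrite !mem_cat ret_h r_q /= inE eqxx orbT.
suff -> : pull inl s' = after_call z (pull inl s) (last (pull h t) ts).
  apply: StepCall.
  - exact: Feasible p_steps.
  (* Via the fresh incarnations 0: the summary equates them with the entry values of the run, the
     assumptions with the arguments. *)
  - transitivity [seq s (fresh site (inr x, 0)) | x <- params P'].
      rewrite params_h -map_comp; apply/eq_in_map => x x_q /=.
      by case: (t_s _ (visible_param x x_q)).
    apply: eq_map_zip; first by rewrite params_h size_map.
    by move=> xe /s_es /=; rewrite eval_map.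
  move=> g; rewrite /pull /=; case: (t_s _ (visible_global g)) => -> _.
  by apply: (s_g g); apply: mem_In; rewrite mem_enum.
(* The globals now hold the maximal incarnations, which are the final values of the callee's run. *)
have m_pull y : pull inl m y =
    match y with inl g => pull h t' (inl g) | inr _ => pull inl s y end.
  case: y => [g|y] /=; last exact: m_l.
  rewrite /pull /= m_g mem_enum /=.
  by case: (t_s _ (visible_global g)).
rewrite s'_def p_last ret_h /after_call.
case: z {s'_def} => [x|] /=; case r_q: (ret (prog q)) => [r|] /=;
  try by apply: functional_extensionality.
rewrite pull_upd //; congr upd; first exact: functional_extensionality.
by rewrite m_l; case: (t_s _ (visible_ret r r_q)).
Qed.

Lemma replaced_run b : wf_body P ->
  List.Forall2 (fun c ch => forall s s',
    run P_sharp ch s s' -> step P c (pull inl s) (pull inl s'))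
    (body b) (replaced q F (Sum TC) b).
Proof.
(* The starting position 0 is generalized, since call sites in the tail of the block are numbered
   from a later position. *)
move=> /(_ b); rewrite /replaced; elim: (body b) 0 => [|c cs IH] n wf /=.
  by constructor.
constructor; last by apply: IH => d d_cs; apply: wf; right.
by move=> s s'; apply: replace_run; apply: wf; left.
Qed.

Lemma sharp_feasible (bs : seq (lab P)) ss : wf_body P ->
  feasible prog P_sharp bs ss ->
  feasible prog P bs (forget q F (Sum TC) bs ss).
Proof.
move=> wf [p ss' p_complete p_steps]; apply: Feasible; first exact: p_complete.
apply: (@steps_milestones P P_sharp inl).
  rewrite /stmts_along; elim: p {p_complete p_steps} => [|b p IH] /=.
    by constructor.
  by apply: List.Forall2_app => //; apply: replaced_run.
(* Flattening chunks within each block agrees with flattening the list of all chunks along the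
   path. *)
congr (steps P_sharp _ ss'): p_steps; rewrite /stmts_along.
by elim: p {p_complete} => //= b p ->; rewrite flatten_cat.
Qed.

End Sharp.

End Simulation.

Theorem lemma3 (M : structure) (G : finType) (name : eqType)
    (prog : name -> proc M G name) (wf : wf_prog prog)
    (p p' : name) (p_neq_p' : p != p')
    (P_loop_free : loop_free (prog p)) (P_calls_P' : calls (prog p) p')
    (P'_loop_free : loop_free (prog p'))
    (P' : proc M G name) (P'_inlined : inlines prog (prog p') P')
    (P'_call_free : call_free P')
    (F : ssa P') (F_ssa : ssa_form F)
    (TC : seq (valuation F))
    (TC_sat : forall nu : valuation F, List.In nu TC ->
       holds nu.1 nu.2 (VC F) /\ nu.2 (RVar ord0) = true)
    (bs : seq (lab (prog p)))
    (ss : seq (state M G (loc (sharp (prog p) p' F (Sum TC))))) :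
  feasible prog (sharp (prog p) p' F (Sum TC)) bs ss ->
  feasible prog (prog p) bs (forget p' F (Sum TC) bs ss).
Proof.
have [h [params_h ret_h P'_ranked P'_run]] :=
  inlines_run wf P'_inlined (wf_proc_body (wf p')) (acyclic_ranked P'_loop_free).
exact: (sharp_feasible F_ssa TC_sat P'_ranked params_h ret_h P'_run
          (wf_proc_body (wf p))).
Qed.
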